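(* Let $S$ be a sampling with replacement consisting of $\tau$ independent draws from a distribution on $[n]$ with probabilities $\tilde p_i>0$, and let each $f_i:\mathbb{R}^d\to\mathbb{R}$ be $L_i$-smooth. Then the constant $\mathcal{L}_3$ (defined in the context) satisfies $$\mathcal{L}_3\le\frac{1}{n^2\tau}\sum_{i=1}^n\frac{L_i^2}{\tilde p_i}.$$
   Context: $[n]=\{1,\dots,n\}$; $e\in\mathbb{R}^n$ is the all-ones vector. $L$-smooth means differentiable with $L$-Lipschitz gradient; the $f_i$ need not be convex. Sampling with replacement: $S$ is the multiset of $\tau\ge1$ independent indices, each equal to $i$ with probability $\tilde p_i$. Weights: $\theta_S^i=1/(\tau\tilde p_i)$; $\theta_S$ is the diagonal matrix with these entries; $\mathbf{I}_S$ is the diagonal matrix whose $i$-th entry is the number of copies of $i$ in $S$; $\mathbf{G}(x)=[\nabla f_1(x),\dots,\nabla f_n(x)]$. Thus $\frac1n\mathbf{G}(x)\theta_S\mathbf{I}_Se=\frac1n\sum_{i\in S}\frac{1}{\tau\tilde p_i}\nabla f_i(x)$ with multiplicities. $\mathcal{L}_3$ is the smallest constant $\ge0$ such that for all $x,y\in\mathbb{R}^d$: $\mathbb{E}\left[\|\frac1n(\mathbf{G}(x)-\mathbf{G}(y))\theta_S\mathbf{I}_Se-\frac1n(\mathbf{G}(x)-\mathbf{G}(y))e\|^2\right]\le\mathcal{L}_3\|x-y\|^2$. *)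

(* Defs.v *)
From HB Require Import structures.
From mathcomp Require Import all_boot all_order all_algebra.
From mathcomp Require Import all_classical all_reals all_analysis.

Set Implicit Arguments.
Unset Strict Implicit.
Unset Printing Implicit Defensive.

Import Order.TTheory GRing.Theory Num.Theory.
Import numFieldNormedType.Exports.

Local Open Scope classical_set_scope.
Local Open Scope ring_scope.

(* The library norm `|x| on matrices is the max norm, hence this definition. *)
Definition norm2 (R : realType) (d : nat) (x : 'cV[R]_d) : R :=
  Num.sqrt (\sum_(k < d) x k 0 ^+ 2).

Definition grad (R : realType) (d : nat) (f : 'cV[R]_d -> R) (x : 'cV[R]_d)
    : 'cV[R]_d :=
  \col_(k < d) 'D_(delta_mx k 0) f x.

(* [differentiable] is relative to the max norm, which is equivalent to the
   Euclidean one; the Lipschitz condition is in the Euclidean norm. *)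
Definition smooth (R : realType) (d : nat) (L : R) (f : 'cV[R]_d -> R) : Prop :=
  (forall x, differentiable f x) /\
  (forall x y, norm2 (grad f x - grad f y) <= L * norm2 (x - y)).

Definition gradmx (R : realType) (d n : nat) (f : 'I_n -> 'cV[R]_d -> R)
    (x : 'cV[R]_d) : 'M[R]_(d, n) :=
  \matrix_(k < d, i < n) grad (f i) x k 0.

(* Taking the A t arbitrary (possibly full) subsets of 'I_n makes the product
   rule over all of 'I_tau imply the one over every subfamily. *)
Definition independent_draws (disp : measure_display) (T : measurableType disp)
    (R : realType) (P : probability T R) (n tau : nat)
    (X : 'I_tau -> T -> 'I_n) : Prop :=
  forall A : 'I_tau -> set 'I_n,
    P (\bigcap_(t in [set: 'I_tau]) (X t @^-1` A t)) =
    (\prod_(t < tau) P (X t @^-1` A t))%E.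

Definition sampling_with_replacement (disp : measure_display)
    (T : measurableType disp) (R : realType) (P : probability T R) (n tau : nat)
    (p : 'I_n -> R) (X : 'I_tau -> T -> 'I_n) : Prop :=
  [/\ forall t (A : set 'I_n), measurable (X t @^-1` A),
      forall t i, P (X t @^-1` [set i]) = (p i)%:E
    & independent_draws P X].

(* The random multiset S, represented by the list of its elements. *)
Definition draws (T : Type) (n tau : nat) (X : 'I_tau -> T -> 'I_n) (w : T)
    : seq 'I_n :=
  [seq X t w | t <- enum 'I_tau].

Definition multmx (R : realType) (n : nat) (S : seq 'I_n) : 'M[R]_n :=
  diag_mx (\row_(i < n) (count_mem i S)%:R).

Definition weightmx (R : realType) (n tau : nat) (p : 'I_n -> R) : 'M[R]_n :=
  diag_mx (\row_(i < n) (1 / (tau%:R * p i))).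

Definition deviation (R : realType) (d n tau : nat) (p : 'I_n -> R)
    (f : 'I_n -> 'cV[R]_d -> R) (S : seq 'I_n) (x y : 'cV[R]_d) : 'cV[R]_d :=
  let DG := gradmx f x - gradmx f y in
  let e : 'cV[R]_n := const_mx 1 in
  n%:R^-1 *: (DG *m weightmx tau p *m multmx R S *m e) - n%:R^-1 *: (DG *m e).

Definition L3_bounds (disp : measure_display) (T : measurableType disp)
    (R : realType) (P : probability T R) (d n tau : nat) (p : 'I_n -> R)
    (X : 'I_tau -> T -> 'I_n) (f : 'I_n -> 'cV[R]_d -> R) : set R :=
  [set L | 0 <= L /\ forall x y : 'cV[R]_d,
    ('E_P[fun w : T => (norm2 (deviation tau p f (draws X w) x y) ^+ 2)%R]
       <= (L * norm2 (x - y) ^+ 2)%:E)%E].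

Definition is_L3 (disp : measure_display) (T : measurableType disp)
    (R : realType) (P : probability T R) (d n tau : nat) (p : 'I_n -> R)
    (X : 'I_tau -> T -> 'I_n) (f : 'I_n -> 'cV[R]_d -> R) (L3 : R) : Prop :=
  L3_bounds P p X f L3 /\ lbound (L3_bounds P p X f) L3.

(* Main.v *)
Require Import Defs.
From mathcomp Require Import all_boot all_order all_algebra.
From mathcomp Require Import all_classical all_reals all_analysis.
From mathcomp Require Import ring.

Set Implicit Arguments.
Unset Strict Implicit.
Unset Printing Implicit Defensive.

Import Order.TTheory GRing.Theory Num.Theory.
Import numFieldNormedType.Exports.

Local Open Scope ring_scope.

(** Write a_i for the difference of the gradients of f_i at x and y. In each
    coordinate, the deviation is 1 / (n tau) times the sum over the tau draws of
    a_i / p_i - \sum_j a_j, where i is the index drawn ([deviationE]). These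
    terms are independent and centred, since a_i / p_i has mean \sum_j a_j, so
    the cross terms vanish in the expectation of the square ([iid_sum_sqr]); the
    variance of one term is at most its second moment \sum_i a_i^2 / p_i
    ([variance_le_second_moment]). Summing over the coordinates bounds the
    expectation by 1 / (n^2 tau) \sum_i |a_i|^2 / p_i
    ([expectation_deviation_le]), and smoothness gives |a_i| <= L_i |x - y|.

    So the claimed bound is an admissible constant; in particular the set of
    admissible constants is nonempty, and it contains its infimum
    ([L3_exists]), which is the smallest constant. *)

Lemma norm2_ge0 (R : realType) (d : nat) (x : 'cV[R]_d) : 0 <= norm2 x.
Proof. exact: sqrtr_ge0. Qed.

Lemma norm2_sqr (R : realType) (d : nat) (x : 'cV[R]_d) :
  norm2 x ^+ 2 = \sum_(k < d) x k 0 ^+ 2.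
Proof. by rewrite sqr_sqrtr// sumr_ge0// => k _; exact: sqr_ge0. Qed.

(** The expectation of a function of a finitely valued random variable Z of law
    q is a finite sum; no sign condition on g is needed. *)
Lemma expectation_fin_valued (disp : measure_display) (T : measurableType disp)
    (R : realType) (P : probability T R) (I : finType) (Z : T -> I)
    (q g : I -> R) :
  (forall i, measurable (Z @^-1` [set i])%classic) ->
  (forall i, P (Z @^-1` [set i])%classic = (q i)%:E) ->
  ('E_P[fun w => g (Z w)] = (\sum_i q i * g i)%R%:E)%E.
Proof.
move=> mZ PZ; rewrite unlock.
have gE w : (g (Z w))%:E =
    (\sum_i (g i)%:E * (\1_(Z @^-1` [set i])%classic w)%:E)%E.
  rewrite (bigD1 (Z w))//= big1 ?adde0 => [|i iZ]; rewrite indicE.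
    by rewrite mem_set// mule1.
  by rewrite memNset ?mule0// => Zi; rewrite -Zi eqxx in iZ.
have iZ i : P.-integrable setT (fun w => (\1_(Z @^-1` [set i])%classic w)%:E).
  exact: integrable_indic.
under eq_integral do rewrite gE.
rewrite integral_sum//; last by move=> i; exact: integrableZl.
rewrite -sumEFin; apply: eq_bigr => i _.
rewrite integralZl// integral_indic// setIT mulrC EFinM.
by congr (_ * _)%E; exact: PZ.
Qed.

Section JointLaw.
Context {disp : measure_display} {T : measurableType disp} {R : realType}.
Context {P : probability T R} {n tau : nat} {p : 'I_n -> R}.
Context {X : 'I_tau -> T -> 'I_n}.
Context (X_sampling : sampling_with_replacement P p X).

(** The tuple of all draws. *)
Let Z (w : T) : {ffun 'I_tau -> 'I_n} := [ffun t => X t w].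

Let joint_preimage v :
  (Z @^-1` [set v] =
   \bigcap_(t in [set: 'I_tau]) (X t @^-1` [set v t]))%classic.
Proof.
apply/seteqP; split=> w /=; first by move=> <- t _ /=; rewrite ffunE.
by move=> Xv; apply/ffunP => t; rewrite ffunE; exact: Xv.
Qed.

(** The tuple of all draws is a random variable with values in a finite type,
    whose law is the product of the laws of the draws. *)
Lemma expectation_sampling (g : {ffun 'I_tau -> 'I_n} -> R) :
  ('E_P[fun w => g [ffun t => X t w]] =
   (\sum_(v : {ffun _ -> _}) (\prod_t p (v t)) * g v)%R%:E)%E.
Proof.
have [mX pX iX] := X_sampling.
apply: (@expectation_fin_valued _ _ _ _ _ Z (fun v => \prod_t p (v t))) => v.
  rewrite joint_preimage; apply: fin_bigcap_measurable => [|t _].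
    exact: finite_finset.
  exact: mX.
rewrite joint_preimage.
rewrite (iX (fun t => [set v t]%classic)) -prodEFin.
by apply: eq_bigr => t _; exact: pX.
Qed.

End JointLaw.

(** The second moment of a sum of tau independent centred variables is tau times
    that of one of them: the factor of the draw t vanishes in each cross term
    c (v t) * c (v s) with s != t. *)
Lemma iid_sum_sqr (R : comPzRingType) (I : finType) (tau : nat) (p c : I -> R) :
  \sum_i p i = 1 -> \sum_i p i * c i = 0 ->
  \sum_(v : {ffun 'I_tau -> I}) (\prod_t p (v t)) * (\sum_t c (v t)) ^+ 2 =
  tau%:R * \sum_i p i * c i ^+ 2.
Proof.
move=> p1 pc0.
(* The indicator factors make c (v t) * c (v s) a product over all draws u, so
   that the sum over outcomes v factors into sums over single draws. *)
pose h (t s u : 'I_tau) i :=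
  (if u == t then c i else 1) * (if u == s then c i else 1).
have hprod (v : {ffun 'I_tau -> I}) t s :
    \prod_u h t s u (v u) = c (v t) * c (v s).
  by rewrite big_split /= -!big_mkcond !big_pred1_eq.
transitivity (\sum_t \sum_s \prod_u \sum_i p i * h t s u i).
  under [RHS]eq_bigr do under eq_bigr do rewrite bigA_distr_bigA.
  rewrite pair_bigA exchange_big /=; apply: eq_bigr => v _.
  rewrite expr2 big_distrlr pair_bigA /= mulr_sumr.
  apply: eq_bigr => -[t s] _ /=.
  by rewrite big_split hprod.
have h1 t s u : u != t -> u != s -> \sum_i p i * h t s u i = 1.
  move=> /negPf ut /negPf us; rewrite -[RHS]p1; apply: eq_bigr => i _.
  by rewrite /h ut us !mulr1.
have cross t s : s != t -> \prod_u \sum_i p i * h t s u i = 0.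
  move=> st; rewrite (bigD1 t)//= [X in X * _](_ : _ = 0) ?mul0r//.
  rewrite -[RHS]pc0; apply: eq_bigr => i _.
  by rewrite /h eqxx eq_sym (negPf st) mulr1.
have diag t : \prod_u \sum_i p i * h t t u i = \sum_i p i * c i ^+ 2.
  rewrite (bigD1 t)//= [X in _ * X]big1 ?mulr1 => [|u ut]; last exact: h1.
  by apply: eq_bigr => i _; rewrite /h eqxx expr2.
transitivity (\sum_(t < tau) \sum_i p i * c i ^+ 2).
  apply: eq_bigr => t _; rewrite (bigD1 t)//= diag.
  rewrite [X in _ + X]big1 ?addr0// => s st.
  exact: cross.
by rewrite sumr_const card_ord mulr_natl.
Qed.

Lemma variance_le_second_moment (R : realDomainType) (I : finType)
    (p b : I -> R) :
  \sum_i p i = 1 ->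
  \sum_i p i * (b i - \sum_j p j * b j) ^+ 2 <= \sum_i p i * b i ^+ 2.
Proof.
move=> p1; set m := \sum_j p j * b j.
suff -> : \sum_i p i * (b i - m) ^+ 2 = \sum_i p i * b i ^+ 2 - m ^+ 2.
  by rewrite lerBlDr lerDl sqr_ge0.
transitivity (\sum_i p i * b i ^+ 2 - 2 * m * (\sum_i p i * b i)
              + m ^+ 2 * \sum_i p i).
  rewrite [X in _ - X + _]mulr_sumr [X in _ + X]mulr_sumr -sumrB -big_split /=.
  by apply: eq_bigr => i _; ring.
by rewrite p1 -/m; ring.
Qed.

(** Each coordinate of the deviation is 1 / n times the average over the draws
    of the centred variables a i / p i - \sum_j a j, where a i is that coordinate
    of the difference of the i-th gradients. The identity also holds for n = 0,
    with 0^-1 = 0. *)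
Lemma deviationE (R : realType) (d n tau : nat) (p : 'I_n -> R)
    (f : 'I_n -> 'cV[R]_d -> R) (v : 'I_tau -> 'I_n) (x y : 'cV[R]_d)
    (k : 'I_d) :
  (0 < tau)%N ->
  let a i := (grad (f i) x - grad (f i) y) k 0 in
  deviation tau p f [seq v t | t <- enum 'I_tau] x y k 0 =
  (n%:R * tau%:R)^-1 * \sum_t (a (v t) / p (v t) - \sum_i a i).
Proof.
move=> tau_gt0 a; have tau0 : tau%:R != 0 :> R by rewrite pnatr_eq0 -lt0n.
rewrite /deviation !mxE.
have aE i : (gradmx f x - gradmx f y) k i = a i by rewrite /a !mxE.
have -> : \sum_j (gradmx f x - gradmx f y) k j * (const_mx 1 : 'cV_n) j 0 =
    \sum_i a i.
  by apply: eq_bigr => i _; rewrite aE mxE mulr1.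
set W := _ *m multmx _ _.
have -> : \sum_j W k j * (const_mx 1 : 'cV_n) j 0 =
    tau%:R^-1 * \sum_t a (v t) / p (v t).
  transitivity
    (\sum_i \sum_t (if i == v t then tau%:R^-1 * (a i / p i) else 0)).
    apply: eq_bigr => i _.
    rewrite /W /multmx /weightmx mul_mx_diag mxE mul_mx_diag mxE aE !mxE mulr1.
    rewrite count_map -sum1_count natr_sum big_mkcond /= big_enum /=.
    rewrite mulr_sumr; apply: eq_bigr => t _; rewrite eq_sym.
    by case: ifP; rewrite ?mulr0// => _; rewrite mulr1 div1r invfM; ring.
  rewrite exchange_big mulr_sumr; apply: eq_bigr => t _ /=.
  by rewrite -big_mkcond big_pred1_eq.
rewrite sumrB sumr_const card_ord -[(\sum_i _) *+ tau]mulr_natl invfM.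
by rewrite -[RHS]mulrA [X in _ = _ * X]mulrBr mulKf// mulrBr.
Qed.

Lemma expectation_deviation_le (disp : measure_display)
    (T : measurableType disp) (R : realType) (P : probability T R)
    (d n tau : nat) (p : 'I_n -> R) (X : 'I_tau -> T -> 'I_n)
    (f : 'I_n -> 'cV[R]_d -> R) (x y : 'cV[R]_d) :
  (0 < tau)%N -> (forall i, 0 < p i) -> \sum_i p i = 1 ->
  sampling_with_replacement P p X ->
  ('E_P[fun w : T => (norm2 (deviation tau p f (draws X w) x y) ^+ 2)%R] <=
   (1 / (n%:R ^+ 2 * tau%:R) *
    \sum_i norm2 (grad (f i) x - grad (f i) y) ^+ 2 / p i)%:E)%E.
Proof.
move=> tau_gt0 p_gt0 p1 XP.
have tau0 : tau%:R != 0 :> R by rewrite pnatr_eq0 -lt0n.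
pose a k i := (grad (f i) x - grad (f i) y) k 0.
pose g (v : {ffun 'I_tau -> 'I_n}) : R :=
  \sum_k (n%:R * tau%:R)^-2 *
    (\sum_t (a k (v t) / p (v t) - \sum_i a k i)) ^+ 2.
have -> : (fun w => norm2 (deviation tau p f (draws X w) x y) ^+ 2) =
    (fun w => g [ffun t => X t w]).
  apply/funext => w; rewrite norm2_sqr; apply: eq_bigr => k _.
  rewrite deviationE// exprMn exprVn; congr (_ * _ ^+ 2).
  by apply: eq_bigr => t _; rewrite ffunE.
rewrite (expectation_sampling XP) lee_fin.
have meanE k : \sum_i p i * (a k i / p i) = \sum_i a k i.
  by apply: eq_bigr => i _; rewrite mulrC divfK// gt_eqF.
have -> : \sum_(v : {ffun _ -> _}) (\prod_t p (v t)) * g v =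
    1 / (n%:R ^+ 2 * tau%:R) *
    \sum_k \sum_i p i * (a k i / p i - \sum_j a k j) ^+ 2.
  under eq_bigr do rewrite mulr_sumr.
  rewrite exchange_big mulr_sumr; apply: eq_bigr => k _ /=.
  under eq_bigr do rewrite mulrCA.
  rewrite -mulr_sumr.
  rewrite (@iid_sum_sqr _ _ _ _ (fun i => a k i / p i - \sum_j a k j))//.
    rewrite mulrA div1r exprMn [tau%:R ^+ 2]expr2 (mulrA (n%:R ^+ 2)).
    by rewrite invfM divfK.
  under eq_bigr do rewrite mulrBr.
  by rewrite sumrB -mulr_suml p1 mul1r meanE subrr.
rewrite ler_wpM2l ?divr_ge0 ?mulr_ge0 ?exprn_ge0//.
under [leRHS]eq_bigr do rewrite norm2_sqr mulr_suml.
rewrite [leRHS]exchange_big; apply: ler_sum => k _ /=; rewrite -meanE.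
apply: le_trans (variance_le_second_moment _ _) _ => //.
rewrite le_eqVlt; apply/predU1l/eq_bigr => i _.
rewrite -/(a k i) expr_div_n expr2 invfM.
by rewrite mulrCA [p i * _]mulrA divff ?mul1r// gt_eqF.
Qed.

(** The infimum of the admissible constants is admissible: where x != y, the
    quotient of the expectation by norm2 (x - y) ^+ 2 is a lower bound of them,
    and otherwise the inequality does not depend on the constant. *)
Lemma L3_exists (disp : measure_display) (T : measurableType disp)
    (R : realType) (P : probability T R) (d n tau : nat) (p : 'I_n -> R)
    (X : 'I_tau -> T -> 'I_n) (f : 'I_n -> 'cV[R]_d -> R) :
  (L3_bounds P p X f !=set0)%classic -> is_L3 P p X f (inf (L3_bounds P p X f)).
Proof.
move=> B0; have lb0 : lbound (L3_bounds P p X f) 0 by move=> L [].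
split; last by apply: ge_inf; exists 0.
split=> [|x y]; first exact: lb_le_inf.
have [C [_ /(_ x y) EC]] := B0.
have : (0%E <=
    'E_P[fun w => (norm2 (deviation tau p f (draws X w) x y) ^+ 2)%R])%E.
  by apply: expectation_ge0 => w; exact: sqr_ge0.
move: EC (fun L (h : L3_bounds P p X f L) => h.2 x y).
case: expectation => //= E; rewrite !lee_fin => EC EL E0.
have [xy0|xy0] := eqVneq (norm2 (x - y) ^+ 2) 0.
  by move: EC; rewrite xy0 !mulr0.
have xy_gt0 : 0 < norm2 (x - y) ^+ 2 by rewrite lt0r xy0 sqr_ge0.
rewrite -ler_pdivrMr//; apply: lb_le_inf => // L /EL.
by rewrite lee_fin ler_pdivrMr.
Qed.

Theorem lemmaH5 (R : realType) (d n tau : nat)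
    (f : 'I_n -> 'cV[R]_d -> R) (L : 'I_n -> R) (p : 'I_n -> R)
    (disp : measure_display) (T : measurableType disp) (P : probability T R)
    (X : 'I_tau -> T -> 'I_n)
    (tau_ge1 : (1 <= tau)%N)
    (p_gt0 : forall i, 0 < p i) (p_sum1 : \sum_(i < n) p i = 1)
    (X_sampling : sampling_with_replacement P p X)
    (f_smooth : forall i, smooth (L i) (f i)) :
  exists L3 : R, is_L3 P p X f L3 /\
    L3 <= 1 / (n%:R ^+ 2 * tau%:R) * \sum_(i < n) (L i ^+ 2 / p i).
Proof.
set C := 1 / _ * _.
have k0 : 0 <= 1 / (n%:R ^+ 2 * tau%:R) :> R.
  by rewrite divr_ge0 ?mulr_ge0 ?exprn_ge0.
have BC : L3_bounds P p X f C.
  split=> [|x y].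
    rewrite mulr_ge0// sumr_ge0// => i _.
    by rewrite divr_ge0 ?sqr_ge0// ltW.
  have E_le := expectation_deviation_le f x y tau_ge1 p_gt0 p_sum1 X_sampling.
  apply: (le_trans E_le).
  rewrite lee_fin /C -[leRHS]mulrA ler_wpM2l// mulr_suml; apply: ler_sum => i _.
  rewrite [leRHS]mulrAC -[X in _ <= X / _]exprMn.
  rewrite ler_wpM2r ?invr_ge0 ?(ltW (p_gt0 i))//.
  have [_ Li] := f_smooth i.
  by rewrite lerXn2r ?nnegrE ?norm2_ge0// (le_trans (norm2_ge0 _) (Li x y)).
have L3P := L3_exists (ex_intro _ C BC).
by exists (inf (L3_bounds P p X f)); split=> //; exact: L3P.2.
Qed.
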